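(* Let $$K=\{x\in\mathbb{R}^n: g_i(x)\le 0,\ i\in[m],\ h_j(x)=0,\ j\in[\ell]\}$$ be nonempty, where $g_1,\dots,g_m$ are convex polynomial functions and $h_1,\dots,h_\ell$ are affine functions on $\mathbb{R}^n$. Let $p,q$ be real polynomials in $n$ variables with $q(x)>0$ for all $x\in K$, and let $f=p/q$. Assume that the Abadie constraint qualification holds at every point of $K$. If for every $\alpha\subset[m]$ the rank of the matrix $D\Psi_\alpha(x,\lambda_\alpha)$ is constant for $(x,\lambda_\alpha)\in\mathbb{R}^n\times\mathbb{R}^{|\alpha|}$, with constant value denoted $\operatorname{rank}(D\Psi_\alpha)$, then $$\dim(\operatorname{Stat}(K,f))\le\max_{\alpha\subset[m]}\Big\{\min\{\dim(K_\alpha),\ n+|\alpha|+\ell-\operatorname{rank}(D\Psi_\alpha)\}\Big\}.$$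
   Context: Notation: $[m]=\{1,\dots,m\}$; subsets $\alpha\subset[m]$ may be empty or all of $[m]$. $\operatorname{Stat}(K,f)$ is the set of stationary points of the problem of minimizing $f$ over $K$, i.e. $\operatorname{Stat}(K,f)=\{x\in K:\langle\nabla f(x),y-x\rangle\ge 0\ \text{for all } y\in K\}$; it is a semialgebraic set. Pseudo-faces: for $\alpha\subset[m]$, $K_\alpha=\{x\in\mathbb{R}^n: g_i(x)=0\ \forall i\in\alpha,\ g_i(x)<0\ \forall i\in[m]\setminus\alpha,\ h_j(x)=0\ \forall j\in[\ell]\}$. For $\alpha\subset[m]$, write $g_\alpha=(g_i)_{i\in\alpha}$, $\lambda_\alpha=(\lambda_i)_{i\in\alpha}$, $h=(h_1,\dots,h_\ell)$, and define $\Psi_\alpha:\mathbb{R}^n\times\mathbb{R}^{|\alpha|}\times\mathbb{R}^\ell\to\mathbb{R}^{n+|\alpha|+\ell}$ by $$\Psi_\alpha(x,\lambda_\alpha,\mu)=\Big((q\nabla p-p\nabla q)(x)+\sum_{i\in\alpha}\lambda_i\nabla g_i(x)+\sum_{j\in[\ell]}\mu_j\nabla h_j(x),\ g_\alpha(x),\ h(x)\Big)^T.$$ Its Jacobian does not depend on $\mu$ and is $$D\Psi_\alpha(x,\lambda_\alpha)=\begin{bmatrix} Q(x)+\sum_{i\in\alpha}\lambda_i\nabla^2 g_i(x) & \nabla g_\alpha(x) & \nabla h(x)\\ \nabla g_\alpha(x)^T&0&0\\ \nabla h(x)^T&0&0\end{bmatrix},$$ where $Q(x)$ is the Jacobian matrix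 of the polynomial map $q\nabla p-p\nabla q$, $\nabla^2 g_i$ is the Hessian of $g_i$, and $\nabla g_\alpha(x)$, $\nabla h(x)$ are the matrices whose columns are the gradients $\nabla g_i(x)$ ($i\in\alpha$) and $\nabla h_j(x)$ ($j\in[\ell]$). Abadie constraint qualification (ACQ) at $x\in K$: $L_K(x)=T_K(x)$, where $T_K(x)$ is the set of $v\in\mathbb{R}^n$ for which there are $y^k\in K$ and $t^k>0$ with $y^k\to x$, $t^k\to 0$, $(y^k-x)/t^k\to v$; and $L_K(x)=\{v:\langle\nabla g_i(x),v\rangle\le 0\ \forall i\in I(x),\ \langle\nabla h_j(x),v\rangle=0\ \forall j\in[\ell]\}$ with $I(x)=\{i\in[m]:g_i(x)=0\}$. Dimension: every semialgebraic set $S$ is a finite disjoint union of semialgebraic subsets $S_i$ semialgebraically diffeomorphic to $(0,1)^{d_i}$ (with $(0,1)^0$ a point), and $\dim S=\max_i d_i$; convention $\dim(\emptyset)=-\infty$. *)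

(* Defs.v *)
From HB Require Import structures.
From mathcomp Require Import all_boot all_order all_algebra.
From mathcomp Require Import all_classical all_reals all_analysis.
(* The notations of mpoly clash with those of mathcomp-analysis. *)
From mathcomp Require mpoly.
Import -(notations) mpoly.
Import Order.TTheory GRing.Theory Num.Theory numFieldNormedType.Exports.

Set Implicit Arguments.
Unset Strict Implicit.
Unset Printing Implicit Defensive.

Local Open Scope classical_set_scope.
Local Open Scope ring_scope.

Section Polynomials.
Context {R : realType} {n : nat}.
Implicit Types (p q : mpoly n R) (x u v : 'rV[R]_n).

Definition peval p x : R := meval (fun i => x 0 i) p.

Definition dotv u v : R := \sum_(i < n) u 0 i * v 0 i.

Definition is_affine (f : 'rV[R]_n -> R) : Prop :=
  exists (a : 'rV[R]_n) (b : R), forall x, f x = dotv a x + b.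

Definition grad (f : 'rV[R]_n -> R) x : 'rV[R]_n :=
  \row_(i < n) 'D_(delta_mx 0 i) f x.

Definition pgrad p x : 'rV[R]_n := \row_(i < n) peval (mderiv i p) x.

Definition phess p x : 'M[R]_n :=
  \matrix_(a < n, b < n) peval (mderiv b (mderiv a p)) x.

(* Jacobian matrix of the polynomial map [q * grad p - p * grad q]. *)
Definition Qmx p q x : 'M[R]_n :=
  \matrix_(a < n, b < n)
    peval (mderiv b (q * mderiv a p - p * mderiv a q)) x.

End Polynomials.

Section Semialgebraic.
Context {R : realType}.

(* Finite unions of sets given by finitely many polynomial equations [c.1]
   and strict inequalities [c.2]. *)
Definition semialgebraic (n : nat) (S : set 'rV[R]_n) : Prop :=
  exists F : seq (seq (mpoly n R) * seq (mpoly n R)),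
    S = [set x | has (fun c => all (fun p => peval p x == 0) c.1
                            && all (fun p => 0 < peval p x) c.2) F].

(* [Ck k U f]: f is of class C^k on the set U, which is meant to be open. *)
Fixpoint Ck (a b : nat) (k : nat) (U : set 'rV[R]_a)
    (f : 'rV[R]_a -> 'rV[R]_b) : Prop :=
  match k with
  | 0 => forall x, U x -> {for x, continuous f}
  | k'.+1 => (forall x, U x -> differentiable f x) /\
             (forall v : 'rV[R]_a, Ck k' U (fun x => 'D_v f x))
  end.

(* C^oo maps on an arbitrary subset A: those that extend, locally around each
   point of A, to a C^oo map on an open subset of the ambient space. *)
Definition smooth_on (a b : nat) (A : set 'rV[R]_a)
    (f : 'rV[R]_a -> 'rV[R]_b) : Prop :=
  forall x, A x -> exists (U : set 'rV[R]_a) (F : 'rV[R]_a -> 'rV[R]_b),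
    [/\ open U, U x, (forall k, Ck k U F) &
        forall y, U y -> A y -> F y = f y].

Definition semialg_diffeo (a b : nat) (A : set 'rV[R]_a)
    (B : set 'rV[R]_b) : Prop :=
  exists (phi : 'rV[R]_a -> 'rV[R]_b) (psi : 'rV[R]_b -> 'rV[R]_a),
    [/\ (forall x, A x -> B (phi x) /\ psi (phi x) = x),
        (forall y, B y -> A (psi y) /\ phi (psi y) = y),
        smooth_on A phi,
        smooth_on B psi &
        semialgebraic [set row_mx x (phi x) | x in A]].

(* For d = 0 this is the unique point of R^0. *)
Definition cube (d : nat) : set 'rV[R]_d :=
  [set t | forall i, 0 < t 0 i < 1].
Arguments cube : clear implicits.

(* [is_dim S D]: D is the dimension of S, computed from some decomposition of
   S into finitely many cells. The cells are nonempty, so the decomposition of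
   the empty set has no cell, and its dimension is [-oo]. *)
Definition is_dim (n : nat) (S : set 'rV[R]_n) (D : \bar R) : Prop :=
  exists (N : nat) (C : 'I_N -> set 'rV[R]_n) (d : 'I_N -> nat),
    [/\ S = \bigcup_i C i,
        trivIset setT C,
        (forall i, semialgebraic (C i)),
        (forall i, semialg_diffeo (C i) (cube (d i))) &
        D = \big[maxe/-oo%E]_(i < N) ((d i)%:R)%:E].

End Semialgebraic.

Section Problem.
Context {R : realType} {n m l : nat}.
Variables (g : 'I_m -> mpoly n R) (h : 'I_l -> mpoly n R).

Definition feasible : set 'rV[R]_n :=
  [set x | (forall i, peval (g i) x <= 0) /\ (forall j, peval (h j) x = 0)].

Definition pseudo_face (alpha : {set 'I_m}) : set 'rV[R]_n :=
  [set x | [/\ (forall i, i \in alpha -> peval (g i) x = 0),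
               (forall i, i \notin alpha -> peval (g i) x < 0) &
               (forall j, peval (h j) x = 0)]].

Definition stat (K : set 'rV[R]_n) (f : 'rV[R]_n -> R) : set 'rV[R]_n :=
  [set x | K x /\ forall y, K y -> 0 <= dotv (grad f x) (y - x)].

Definition tangent_cone (K : set 'rV[R]_n) (x : 'rV[R]_n) : set 'rV[R]_n :=
  [set v | exists (y : nat -> 'rV[R]_n) (t : nat -> R),
     [/\ (forall k, K (y k) /\ 0 < t k),
         y @ \oo --> x,
         t @ \oo --> (0 : R) &
         (fun k => (t k)^-1 *: (y k - x)) @ \oo --> v]].

Definition linearized_cone (x : 'rV[R]_n) : set 'rV[R]_n :=
  [set v | (forall i, peval (g i) x = 0 -> dotv (pgrad (g i) x) v <= 0) /\
           (forall j, dotv (pgrad (h j) x) v = 0)].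

Definition abadie_cq (x : 'rV[R]_n) : Prop :=
  linearized_cone x = tangent_cone feasible x.

Variables (p q : mpoly n R) (alpha : {set 'I_m}).

(* The multiplier indexed by the k-th element [enum_val k] of alpha is
   [lam 0 k]. *)
Definition DPsi (x : 'rV[R]_n) (lam : 'rV[R]_#|alpha|) :
    'M[R]_(n + (#|alpha| + l)) :=
  let Ga : 'M[R]_(n, #|alpha|) :=
    \matrix_(a, k) pgrad (g (enum_val k)) x 0 a in
  let H : 'M[R]_(n, l) := \matrix_(a, j) pgrad (h j) x 0 a in
  block_mx
    (Qmx p q x + \sum_(k < #|alpha|) lam 0 k *: phess (g (enum_val k)) x)
    (row_mx Ga H)
    (col_mx Ga^T H^T)
    0.

End Problem.

(* Main.v *)
Require Import Defs.
From mathcomp Require Import all_boot all_order all_algebra.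
From mathcomp Require Import all_classical all_reals all_analysis.
From mathcomp Require mpoly.
From mathcomp Require Import ring.
Import -(notations) mpoly.
Import Order.TTheory GRing.Theory Num.Theory numFieldNormedType.Exports.

Set Implicit Arguments.
Unset Strict Implicit.
Unset Printing Implicit Defensive.

Local Open Scope classical_set_scope.
Local Open Scope ring_scope.

(** Let a cell of the stationary set be parametrized by a smooth chart
[psi : (0,1)^d -> R^n]. Both bounds on [d] come from first derivatives at
well-chosen points of the cube.

The feasible set is the disjoint union of the pseudo-faces, each of which is a
finite union of semialgebraic cells. A finite Baire argument ([decided_cover])
gives a nonempty open [W] in the cube which [psi] sends into a single
pseudo-face [K_alpha], and a nonempty open part of [W] which [psi] sends into a
single cell of [K_alpha].

If that cell has dimension [e], then composing [psi] with the chart of the cell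
and back shows that the Jacobian of [psi], which has rank [d], factors through
[R^e]; so [d <= e <= dim K_alpha] ([chart_is_dim_le]).

For the second bound, a direction orthogonal to the active gradients is, by the
constraint qualification, tangent together with its opposite, so stationarity
makes [q grad p - p grad q] orthogonal to it. By linear algebra the system
[M(x) c = F(x)] is then solvable, where the columns of [M] are the active
gradients and [F = p grad q - q grad p] ([kkt_solvable]). Choose [t0] in [W]
where the rank of [M(psi t)] is maximal. Multipliers could then be selected
smoothly near [t0] by Cramer's rule, so that differentiating [Psi_alpha = 0]
along the chart would embed the [d]-dimensional tangent space into the kernel of
[DPsi_alpha]. Instead of selecting multipliers, one keeps a multiplier [c0] at
[psi t0] fixed and clears denominators in Cramer's rule: this gives polynomials
that vanish on [psi(W)], whose derivatives provide the required tangent vectors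
of multipliers ([solvable_linearized]). Hence
[d + rank DPsi_alpha <= n + |alpha| + l] ([tangent_dim_le]). *)

(** * Derivatives of polynomial functions *)

Section PolynomialDerivatives.
Context {R : realType} {n : nat}.
Implicit Types (p q : mpoly n R) (x u v w : 'rV[R]_n).

Lemma dotvC u v : dotv u v = dotv v u.
Proof. by apply: eq_bigr => i _; rewrite mulrC. Qed.

Lemma dotvDl u v w : dotv (u + v) w = dotv u w + dotv v w.
Proof. by rewrite -big_split; apply: eq_bigr => i _; rewrite mxE mulrDl. Qed.

Lemma dotvZl c u v : dotv (c *: u) v = c * dotv u v.
Proof. by rewrite mulr_sumr; apply: eq_bigr => i _; rewrite mxE mulrA. Qed.

Lemma dotvZr c u v : dotv u (c *: v) = c * dotv u v.
Proof. by rewrite dotvC dotvZl dotvC. Qed.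

Lemma dotvNl u v : dotv (- u) v = - dotv u v.
Proof. by rewrite -scaleN1r dotvZl mulN1r. Qed.

Lemma dotv0l v : dotv 0 v = 0.
Proof. by rewrite -(scale0r 0) dotvZl mul0r. Qed.

Lemma dotv_suml I (r : seq I) (P : pred I) (F : I -> 'rV[R]_n) v :
  dotv (\sum_(i <- r | P i) F i) v = \sum_(i <- r | P i) dotv (F i) v.
Proof.
exact: (big_morph (dotv ^~ v) (fun u w => dotvDl u w v) (dotv0l v)).
Qed.

Lemma dotv_delta u i : dotv u (delta_mx 0 i) = u 0 i.
Proof.
rewrite /dotv (bigD1 i) //= big1 => [|j ji].
  by rewrite addr0 mxE !eqxx mulr1.
by rewrite mxE (negbTE ji) andbF mulr0.
Qed.

Lemma pgradD p q x : pgrad (p + q) x = pgrad p x + pgrad q x.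
Proof. by apply/rowP => i; rewrite !mxE /peval mderivD mevalD. Qed.

Lemma pgradN p x : pgrad (- p) x = - pgrad p x.
Proof. by apply/rowP => i; rewrite !mxE /peval mderivN mevalN. Qed.

Lemma pgradC c x : pgrad (mpolyC n c) x = 0.
Proof. by apply/rowP => i; rewrite !mxE /peval mderivC meval0. Qed.

Lemma pgrad_sum I (r : seq I) (P : pred I) (F : I -> mpoly n R) x :
  pgrad (\sum_(i <- r | P i) F i) x = \sum_(i <- r | P i) pgrad (F i) x.
Proof.
apply: (big_morph (pgrad ^~ x) (fun p q => pgradD p q x)).
by rewrite -[0]mpolyC0 pgradC.
Qed.

Lemma pgradM p q x :
  pgrad (p * q) x = peval p x *: pgrad q x + peval q x *: pgrad p x.
Proof.
apply/rowP => i; rewrite !mxE /peval mderivM mevalD !mevalM addrC.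
by congr (_ + _); rewrite mulrC.
Qed.

Definition diff_at p x :=
  is_diff x (peval p : 'rV[R]_n -> R^o) (dotv (pgrad p x) : 'rV[R]_n -> R^o).

Lemma diff_atD p q x : diff_at p x -> diff_at q x -> diff_at (p + q) x.
Proof.
rewrite /diff_at => dp dq.
rewrite (_ : peval (p + q) = (peval p : _ -> R^o) + peval q); last first.
  by apply/funext => y; rewrite /peval mevalD.
apply: is_diff_eq.
apply/funext => v; rewrite pgradD.
change (dotv (pgrad p x) v + dotv (pgrad q x) v
  = dotv (pgrad p x + pgrad q x) v).
by rewrite dotvDl.
Qed.

Lemma diff_atM p q x : diff_at p x -> diff_at q x -> diff_at (p * q) x.
Proof.
rewrite /diff_at => dp dq.
rewrite (_ : peval (p * q) = (peval p : _ -> R^o) * peval q); last first.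
  by apply/funext => y; rewrite /peval mevalM.
apply: is_diff_eq.
apply/funext => v; rewrite pgradM.
change (peval p x * dotv (pgrad q x) v + peval q x * dotv (pgrad p x) v
  = dotv (peval p x *: pgrad q x + peval q x *: pgrad p x) v).
by rewrite dotvDl !dotvZl.
Qed.

Lemma diff_atC c x : diff_at (mpolyC n c) x.
Proof.
rewrite /diff_at.
rewrite (_ : peval (mpolyC n c) = cst c :> ('rV[R]_n -> R^o)); last first.
  by apply/funext => y; rewrite /peval mevalC.
by apply: is_diff_eq; apply/funext => v; rewrite pgradC dotv0l.
Qed.

Lemma diff_atX i x : diff_at (mpolyX R (mnm1 i)) x.
Proof.
have @f : {linear 'rV[R]_n -> R^o}.
  by exists (fun y : 'rV[R]_n => y 0 i : R^o); do 2![eexists];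
    do ?[constructor]; rewrite ?mxE// => ? *; rewrite ?mxE//; move=> ?;
    rewrite !mxE.
rewrite /diff_at (_ : peval _ = f :> ('rV[R]_n -> R^o)); last first.
  by apply/funext => y; rewrite /peval mevalXU.
have f_cont : continuous f by move=> y; exact: coord_continuous.
apply: DiffDef; first exact: linear_differentiable.
rewrite diff_lin //; apply/funext => v.
rewrite /dotv (bigD1 i) //= big1 => [|j ji].
  rewrite addr0 mxE /peval mderivX mnm1E eqxx scale1r.
  rewrite (_ : mnm_sub _ _ = mnm0) ?mpolyX0 ?meval1 ?mul1r //.
  by apply/mnmP => k; rewrite mnmBE subnn mnm0E.
by rewrite mxE /peval mderivX mnm1E eq_sym (negbTE ji) scale0r meval0 mul0r.
Qed.

Lemma diff_peval p x : diff_at p x.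
Proof.
have diff1 : diff_at 1 x by rewrite -mpolyC1; exact: diff_atC.
elim/mpolyind: p => [|c m p _ _ dp]; first by rewrite -mpolyC0; exact: diff_atC.
apply: diff_atD dp; rewrite -mul_mpolyC; apply: diff_atM; first exact: diff_atC.
rewrite mpolyXE_id; elim/big_ind: _ => // [p1 p2|i _]; first exact: diff_atM.
elim: (m i) => [|k IHk]; first by rewrite expr0.
by rewrite exprS; apply: diff_atM => //; exact: diff_atX.
Qed.

Lemma differentiable_peval p x : differentiable (peval p : 'rV[R]_n -> R^o) x.
Proof. by have := diff_peval p x => -[]. Qed.

Lemma derive_peval p x v :
  'D_v (peval p : 'rV[R]_n -> R^o) x = dotv (pgrad p x) v.
Proof.
have [dp dpE] := diff_peval p x.
by rewrite deriveE // dpE.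
Qed.

Lemma pgrad_coord p x i :
  pgrad p x 0 i = 'D_(delta_mx 0 i) (peval p : 'rV[R]_n -> R^o) x.
Proof. by rewrite derive_peval dotv_delta. Qed.

Lemma grad_quot p q x : peval q x != 0 ->
  grad (fun y => peval p y / peval q y) x =
  (peval q x) ^- 2 *: (peval q x *: pgrad p x - peval p x *: pgrad q x).
Proof.
move=> q_neq0; apply/rowP => i; rewrite mxE.
have dP r : derivable (peval r : 'rV[R]_n -> R^o) x (delta_mx 0 i).
  exact/diff_derivable/differentiable_peval.
pose qV : 'rV[R]_n -> R^o := fun y => (peval q y)^-1.
have dV : derivable qV x (delta_mx 0 i) by exact: derivableV.
rewrite -[LHS]/('D_(delta_mx 0 i) ((peval p : 'rV[R]_n -> R^o) * qV) x).
rewrite (deriveM (dP p) dV) (deriveV q_neq0 (dP q)) -!pgrad_coord /qV.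
rewrite -[LHS]/(peval p x * (- (peval q x) ^- 2 * pgrad q x 0 i)
  + (peval q x)^-1 * pgrad p x 0 i).
move: (pgrad p x) (pgrad q x) => u w; rewrite !mxE.
by field.
Qed.

(** The polynomial is only known to be affine as a function, so its second
derivatives are computed analytically: difference quotients of an affine
function do not depend on the base point, so its gradient is constant. *)
Lemma phess_affine p x : is_affine (peval p) -> phess p x = 0.
Proof.
move=> [u [c pE]]; apply/matrixP => i j; rewrite !mxE.
have -> (P : mpoly n R) : peval (mderiv j P) x = pgrad P x 0 j by rewrite mxE.
rewrite pgrad_coord.
have -> : peval (mderiv i p) = cst (peval (mderiv i p) 0);
  last exact: derive_cst.
apply/funext => y /=.
have dE z : peval (mderiv i p) z =
    'D_(delta_mx 0 i) (peval p : 'rV[R]_n -> R^o) z.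
  by rewrite -pgrad_coord mxE.
have quotE (k : R) : (peval p \o shift y) (k *: delta_mx 0 i) - peval p y =
    (peval p \o shift 0) (k *: delta_mx 0 i) - peval p 0.
  by rewrite /= !pE ![dotv u _]dotvC !dotvDl dotv0l; ring.
by rewrite !dE /derive; under eq_fun do rewrite quotE.
Qed.

Lemma dotv_continuous u : continuous (dotv u : 'rV[R]_n -> R^o).
Proof.
pose P : mpoly n R := \sum_(i < n) u 0 i *: mpolyX R (mnm1 i).
have -> : dotv u = peval P.
  apply/funext => v; rewrite /peval raddf_sum; apply: eq_bigr => i _ /=.
  by rewrite mevalZ mevalXU.
by move=> v; exact/differentiable_continuous/differentiable_peval.
Qed.

End PolynomialDerivatives.

(** * Finite covers by semialgebraic sets *)

Section Decided.
Context {T : topologicalType}.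
Implicit Types A B O W : set T.

(** For an open set [O], this says that the boundary of [A] is nowhere dense in
[O]. In this form the stability under Boolean operations is immediate: decide
one set after the other on smaller and smaller pieces. *)
Definition decided O A := forall W, open W -> W !=set0 -> W `<=` O ->
  exists W', [/\ open W', W' !=set0, W' `<=` W & W' `<=` A \/ W' `<=` ~` A].

Lemma decidedC O A : decided O A -> decided O (~` A).
Proof.
move=> decA W oW W0 WO; have [W' [oW' W'0 W'W AW']] := decA W oW W0 WO.
by exists W'; split=> //; rewrite setCK; case: AW'; [right|left].
Qed.

Lemma decidedI O A B : decided O A -> decided O B -> decided O (A `&` B).
Proof.
move=> decA decB W oW W0 WO; have [V [oV V0 VW AV]] := decA W oW W0 WO.
have [V' [oV' V'0 V'V BV']] := decB V oV V0 (subset_trans VW WO).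
exists V'; split=> //; first exact: subset_trans VW.
case: AV => AV; last by right=> x /V'V /AV nAx [].
case: BV' => BV'; first by left=> x V'x; split; [exact/AV/V'V|exact: BV'].
by right=> x /BV' nBx [].
Qed.

Lemma decidedU O A B : decided O A -> decided O B -> decided O (A `|` B).
Proof.
move=> dA dB; rewrite -[_ `|` _]setCK setCU.
by apply/decidedC/decidedI; exact: decidedC.
Qed.

Lemma decided_open O A : (forall t, O t -> A t -> nbhs t A) -> decided O A.
Proof.
move=> Aopen W oW [t0 Wt0] WO.
have [nA|] := pselect (forall t, W t -> ~ A t).
  by exists W; split=> //; [exists t0|right].
move=> /existsNP [t /not_implyP [Wt /contrapT At]].
exists (W `&` A^°); split.
- exact/openI/open_interior.
- by exists t; split=> //; exact/Aopen/At/WO.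
- by move=> ? [].
by left=> x [_]; exact: interior_subset.
Qed.

(** The piece on which all members are decided is found by deciding them one at
a time. *)
Lemma decided_family (I : finType) O (A : I -> set T) W :
    (forall i, decided O (A i)) -> open W -> W !=set0 -> W `<=` O ->
  exists W', [/\ open W', W' !=set0, W' `<=` W &
    (exists i, W' `<=` A i) \/ (forall i, W' `<=` ~` A i)].
Proof.
move=> decA oW W0 WO.
suff [W' [oW' W'0 W'W AW']] : exists W', [/\ open W', W' !=set0, W' `<=` W &
    (exists i, W' `<=` A i) \/ {in enum I, forall i, W' `<=` ~` A i}].
  exists W'; split=> //; case: AW' => [|nA]; [by left|right=> i].
  by apply: nA; rewrite mem_enum.
elim: (enum I) => [|i s [V [oV V0 VW AV]]].
  by exists W; split=> //; right.
case: AV => [AV|nAV]; first by exists V; split=> //; left.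
have [V' [oV' V'0 V'V AV']] := decA i V oV V0 (subset_trans VW WO).
exists V'; split=> //; first exact: subset_trans VW.
case: AV' => [AV'|nAV']; [by left; exists i|right=> j].
rewrite in_cons => /orP [/eqP -> //|js].
exact: subset_trans V'V (nAV j js).
Qed.

Lemma decided_bigcup (I : finType) O (A : I -> set T) :
  (forall i, decided O (A i)) -> decided O (\bigcup_i A i).
Proof.
move=> decA W oW W0 WO.
have [W' [oW' W'0 W'W AW']] := decided_family decA oW W0 WO.
exists W'; split=> //; case: AW' => [[i AW']|nA].
  by left=> t /AW' Ait; exists i.
by right=> t W't [i _]; exact: nA.
Qed.

(** A finite form of the Baire category theorem: by [decided_family] there is a
piece that lies in some member or avoids them all, and the cover excludes the
latter. *)
Lemma decided_cover (I : finType) O (A : I -> set T) W :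
    (forall i, decided O (A i)) -> open W -> W !=set0 -> W `<=` O ->
    W `<=` \bigcup_i A i ->
  exists i W', [/\ open W', W' !=set0, W' `<=` W & W' `<=` A i].
Proof.
move=> decA oW W0 WO WA.
have [W' [oW' W'0 W'W AW']] := decided_family decA oW W0 WO.
case: AW' => [[i AW']|nA]; first by exists i, W'.
by case: W'0 => t W't; have [i _] := WA t (W'W t W't); have := nA i t W't.
Qed.

End Decided.

Section SemialgDecided.
Context {R : realType} {T : topologicalType} {n : nat}.

Lemma decided_semialgebraic (O : set T) (f : T -> 'rV[R]_n) (S : set 'rV[R]_n) :
    (forall t, O t -> {for t, continuous f}) -> semialgebraic S ->
  decided O (f @^-1` S).
Proof.
move=> f_cont [F ->].
have dec_pre p (U : set R^o) : open U -> decided O [set t | U (peval p (f t))].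
  move=> oU; apply: decided_open => t Ot Ut.
  have fp_cont : {for t, continuous ((peval p : _ -> R^o) \o f)}.
    apply: continuous_comp; first exact: f_cont.
    exact/differentiable_continuous/differentiable_peval.
  by apply: (fp_cont U); exact: open_nbhs_nbhs.
have dec_pos p := dec_pre p _ (@open_gt R 0).
have dec_nz p := dec_pre p _ (@open_neq R 0).
pose eqs (ps : seq (mpoly n R)) := [set x | all (fun p => peval p x == 0) ps].
pose ineqs (ps : seq (mpoly n R)) := [set x | all (fun p => 0 < peval p x) ps].
have dec_eqs ps : decided O (f @^-1` eqs ps).
  elim: ps => [|p ps IHps].
    by apply: decided_open => t _ _; apply: filterS filterT.
  rewrite (_ : f @^-1` _ =
      ~` [set t | peval p (f t) != 0] `&` (f @^-1` eqs ps)).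
    exact/decidedI/IHps/decidedC/dec_nz.
  apply/seteqP; split=> t /=.
    by move=> /andP [pt pst]; split=> //; apply/negP; rewrite negbK.
  by move=> [/negP]; rewrite negbK => pt pst; apply/andP.
have dec_ineqs ps : decided O (f @^-1` ineqs ps).
  elim: ps => [|p ps IHps].
    by apply: decided_open => t _ _; apply: filterS filterT.
  rewrite (_ : f @^-1` _ =
      [set t | 0 < peval p (f t)] `&` (f @^-1` ineqs ps)).
    exact/decidedI/IHps/dec_pos.
  by apply/seteqP; split=> t /= /andP.
elim: F => [|c F IHF].
  by apply: decided_open => t _.
rewrite (_ : f @^-1` _ = (f @^-1` eqs c.1 `&` f @^-1` ineqs c.2) `|`
    f @^-1` [set x | has (fun c => all (fun p => peval p x == 0) c.1
                             && all (fun p => 0 < peval p x) c.2) F]).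
  exact/decidedU/IHF/decidedI.
apply/seteqP; split=> t /=.
  by move=> /orP [/andP [? ?]|?]; [left|right].
by move=> [[? ?]|?]; apply/orP; [left; apply/andP|right].
Qed.

Lemma decided_is_dim (O : set T) (f : T -> 'rV[R]_n) (S : set 'rV[R]_n) D :
    (forall t, O t -> {for t, continuous f}) -> is_dim S D ->
  decided O (f @^-1` S).
Proof.
move=> f_cont [N [C [d [-> _ saC _ _]]]].
rewrite preimage_bigcup; apply: decided_bigcup => i.
exact: decided_semialgebraic.
Qed.

End SemialgDecided.

(** * Charts and their Jacobian matrices *)

Section Charts.
Context {R : realType}.
Local Notation cube d := (@cube R d).

Lemma open_cube d : open (cube d : set 'rV[R]_d).
Proof.
rewrite openE => t tin; rewrite /interior.
have near_i i : \forall s \near t, 0 < (s : 'rV[R]_d) 0 i < 1.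
  apply: (@coord_continuous R 1 d 0 i t [set z | 0 < z < 1]).
  apply: (@near_in_itvoo R 0 1 (t 0 i)).
  by rewrite in_itv /=; exact: tin.
have cube_near := @filter_forall _ _ _ _ (nbhs_filter t) near_i.
exact: cube_near.
Qed.

Lemma cube_neq0 d : (cube d : set 'rV[R]_d) !=set0.
Proof.
exists (const_mx (2^-1)) => i; rewrite mxE invr_gt0 ltr0n /= invf_lt1 ?ltr0n //.
by rewrite ltr1n.
Qed.

(** A smooth map on an arbitrary set is handled through a local extension [F];
the set itself may have empty interior. *)
Definition extends_at a b (A : set 'rV[R]_a) (f F : 'rV[R]_a -> 'rV[R]_b) x :=
  differentiable F x /\ \forall y \near x, A y -> F y = f y.

Lemma smooth_on_extends_at a b (A : set 'rV[R]_a) (f : 'rV[R]_a -> 'rV[R]_b) x :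
  smooth_on A f -> A x -> exists F, extends_at A f F x.
Proof.
move=> f_smooth Ax; have [U [F [oU Ux F_Ck FE]]] := f_smooth x Ax.
exists F; split; first by have [F_diff _] := F_Ck 1%N; exact: F_diff.
have : nbhs x U by exact: open_nbhs_nbhs.
by apply: filterS => y Uy; exact: FE.
Qed.

Lemma extends_atS a b (A B : set 'rV[R]_a) (f F : 'rV[R]_a -> 'rV[R]_b) x :
  B `<=` A -> extends_at A f F x -> extends_at B f F x.
Proof.
by move=> BA [Fd FE]; split=> //; apply: filterS FE => y FE /BA; exact: FE.
Qed.

Lemma extends_at_comp a b c (A : set 'rV[R]_a) (B : set 'rV[R]_b)
    (f F : 'rV[R]_a -> 'rV[R]_b) (g G : 'rV[R]_b -> 'rV[R]_c) x :
    A x -> (forall y, A y -> B (f y)) ->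
    extends_at A f F x -> extends_at B g G (f x) ->
  extends_at A (g \o f) (G \o F) x.
Proof.
move=> Ax fAB [F_diff FE] [G_diff GE].
have Fx : F x = f x by exact: (nbhs_singleton FE).
split; first by apply: differentiable_comp => //; rewrite Fx.
have F_cont : F @ x --> F x by exact: differentiable_continuous.
rewrite -Fx in GE.
have {}GE : \forall y \near x, B (F y) -> G (F y) = g (F y).
  exact: (F_cont _ GE).
apply: filterS2 FE GE => y FE GE Ay /=.
by rewrite GE FE //; exact: fAB.
Qed.

Lemma row_jacobian a b (F : 'rV[R]_a -> 'rV[R]_b) x i :
  differentiable F x -> row i (jacobian F x) = 'D_(delta_mx 0 i) F x.
Proof. by move=> F_diff; rewrite rowE (deriveEjacobian _ F_diff). Qed.

Lemma jacobian_extends_at a b (A : set 'rV[R]_a)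
    (f F G : 'rV[R]_a -> 'rV[R]_b) x :
  open A -> A x -> extends_at A f F x -> extends_at A f G x ->
  jacobian F x = jacobian G x.
Proof.
move=> oA Ax [F_diff FE] [G_diff GE].
have Anear : nbhs x A by exact: open_nbhs_nbhs.
apply/row_matrixP => i.
apply: etrans (row_jacobian i F_diff) _.
apply: etrans (esym (row_jacobian i G_diff)).
by apply: near_eq_derive; apply: filterS3 Anear FE GE => y Ay -> // ->.
Qed.

Lemma jacobian_comp a b c (F : 'rV[R]_a -> 'rV[R]_b)
    (G : 'rV[R]_b -> 'rV[R]_c) x :
  differentiable F x -> differentiable G (F x) ->
  jacobian (G \o F) x = jacobian F x *m jacobian G (F x).
Proof.
move=> F_diff G_diff; have GF_diff := differentiable_comp F_diff G_diff.
apply/row_matrixP => i; apply: etrans (row_jacobian i GF_diff) _.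
rewrite row_mul; move: (row_jacobian i F_diff) => ->.
apply: etrans (deriveEjacobian _ G_diff).
by rewrite (deriveE _ GF_diff) (deriveE _ F_diff) (deriveE _ G_diff) diff_comp.
Qed.

Lemma jacobian_id a (x : 'rV[R]_a) : jacobian id x = 1%:M.
Proof.
by apply/row_matrixP => i; rewrite !rowE -deriveEjacobian // derive_id mulmx1.
Qed.

Definition smooth_chart n d (A : set 'rV[R]_n) (phi : 'rV[R]_n -> 'rV[R]_d)
    (psi : 'rV[R]_d -> 'rV[R]_n) :=
  [/\ (forall x, A x -> cube d (phi x) /\ psi (phi x) = x),
      (forall t, cube d t -> A (psi t) /\ phi (psi t) = t),
      smooth_on A phi & smooth_on (cube d) psi].

Lemma chart_continuous n d A (phi : 'rV[R]_n -> 'rV[R]_d) psi t :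
  smooth_chart A phi psi -> cube d t -> {for t, continuous psi}.
Proof.
move=> [_ _ _ psi_smooth] dt.
have [F [F_diff FE]] := smooth_on_extends_at psi_smooth dt.
have nd : nbhs t (cube d).
  by apply: open_nbhs_nbhs; split=> //; exact: open_cube.
have Ft := nbhs_singleton FE dt.
have F_psi : \forall s \near t, F s = psi s.
  by apply: filterS2 nd FE => s ds FE; exact: FE.
have F_cont : F @ t --> F t by exact: differentiable_continuous.
rewrite /prop_for /continuous_at -Ft.
exact: cvg_trans (near_eq_cvg F_psi) F_cont.
Qed.

(** A chart is an immersion: its Jacobian has a right inverse, the Jacobian of
the inverse chart. *)
Lemma rank_jacobian_chart n d A (phi : 'rV[R]_n -> 'rV[R]_d) psi F t :
    smooth_chart A phi psi -> cube d t -> extends_at (cube d) psi F t ->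
  \rank (jacobian F t) = d.
Proof.
move=> [_ psiP phi_smooth _] dt psiF; have [At _] := psiP t dt.
have [G phiG] := smooth_on_extends_at phi_smooth At.
have cube_psi s : cube d s -> A (psi s) by move=> /psiP [].
have GF := extends_at_comp dt cube_psi psiF phiG.
have idE : extends_at (cube d) (phi \o psi) id t.
  split=> //; apply: (@filterE _ (nbhs t) (nbhs_filter t)).
  by move=> s /psiP [_ /= ->].
have [[F_diff FE] [G_diff _]] := (psiF, phiG).
have := jacobian_extends_at (@open_cube d) dt GF idE.
rewrite -(nbhs_singleton FE dt) in G_diff.
rewrite jacobian_comp // jacobian_id => JE.
apply/eqP; rewrite eqn_leq rank_leq_row /=.
by rewrite -{1}(mxrank1 R d) -JE mxrankM_maxl.
Qed.

(** If the image of an open piece of a [d]-dimensional chart lies in a cell of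
dimension [e], then [psi = psi' o (phi' o psi)] on that piece, and the Jacobian
of [psi], which has rank [d], factors through [R^e]. *)
Lemma chart_dim_le n d e A B (phi : 'rV[R]_n -> 'rV[R]_d) psi
    (phi' : 'rV[R]_n -> 'rV[R]_e) psi' (W : set 'rV[R]_d) :
    smooth_chart A phi psi -> smooth_chart B phi' psi' ->
    open W -> W !=set0 -> W `<=` cube d -> (forall t, W t -> B (psi t)) ->
  (d <= e)%N.
Proof.
move=> chart [phi'P _ phi'_smooth psi'_smooth] oW [t Wt] Wd WB.
have [_ _ _ psi_smooth] := chart; have dt := Wd t Wt.
have [F psiF] := smooth_on_extends_at psi_smooth dt.
have JF := rank_jacobian_chart chart dt psiF.
have {}psiF := extends_atS Wd psiF.
have [H phiH] := smooth_on_extends_at phi'_smooth (WB t Wt).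
have [et _] := phi'P _ (WB t Wt).
have [K psiK] := smooth_on_extends_at psi'_smooth et.
have HF := extends_at_comp Wt WB psiF phiH.
have WE s : W s -> cube e (phi' (psi s)) by move=> /WB/phi'P [].
have KHF := extends_at_comp Wt WE HF psiK.
have psiF' : extends_at W (psi' \o (phi' \o psi)) F t.
  case: psiF => F_diff FE; split=> //.
  apply: filterS FE => s FE Ws.
  by rewrite FE //=; have [_ ->] := phi'P _ (WB s Ws).
have JE := jacobian_extends_at oW Wt KHF psiF'.
have [[F_diff FE] [H_diff HE] [K_diff _]] := And3 psiF phiH psiK.
have HFt : (H \o F) t = phi' (psi t).
  by rewrite /= (nbhs_singleton FE Wt) (nbhs_singleton HE (WB t Wt)).
rewrite -(nbhs_singleton FE Wt) in H_diff; rewrite -HFt in K_diff.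
have HF_diff := differentiable_comp F_diff H_diff.
rewrite -JF -JE; apply: leq_trans (rank_leq_col (jacobian (H \o F) t)).
by move: (jacobian_comp HF_diff K_diff) => ->; exact: mxrankM_maxl.
Qed.

(** The tangent space of the chart at [t], as the row space of [J], is
annihilated by the derivatives of all polynomials that vanish on [psi(W)]. *)
Lemma chart_tangent n d A (phi : 'rV[R]_n -> 'rV[R]_d) psi W t :
    smooth_chart A phi psi -> open W -> W t -> W `<=` cube d ->
  exists2 J : 'M[R]_(d, n), \rank J = d & forall p : mpoly n R,
    (forall s, W s -> peval p (psi s) = 0) ->
    forall i, dotv (pgrad p (psi t)) (row i J) = 0.
Proof.
move=> chart oW Wt Wd; have [_ _ _ psi_smooth] := chart; have dt := Wd t Wt.
have [F psiF] := smooth_on_extends_at psi_smooth dt.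
have JF := rank_jacobian_chart chart dt psiF.
exists (jacobian F t) => // p p0 i.
have {psiF} [F_diff FE] := extends_atS Wd psiF.
have Ft := nbhs_singleton FE Wt.
have nW : nbhs t W by exact: open_nbhs_nbhs.
rewrite rowE -(deriveEjacobian _ F_diff) -derive_peval -Ft.
have p_diff := differentiable_peval p (F t).
have pF_diff := differentiable_comp F_diff p_diff.
rewrite (deriveE _ F_diff) (deriveE _ p_diff).
rewrite -[LHS]/(('d (peval p : _ -> R^o) (F t) \o 'd F t) _) -diff_comp //.
rewrite -(deriveE _ pF_diff).
rewrite (@near_eq_derive _ _ _ _ (cst 0)) ?derive_cst //.
by apply: filterS2 nW FE => s Ws FE /=; rewrite FE // p0.
Qed.

Lemma chart_is_dim_le n d A S D (phi : 'rV[R]_n -> 'rV[R]_d) psi W :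
    smooth_chart A phi psi -> is_dim S D ->
    open W -> W !=set0 -> W `<=` cube d -> W `<=` psi @^-1` S ->
  ((d%:R : R)%:E <= D)%E.
Proof.
move=> chart [N [C [e [SE _ saC Cdiffeo ->]]]] oW W0 Wd WS.
have psi_cont t : cube d t -> {for t, continuous psi}.
  exact: chart_continuous chart.
have [j [W' [oW' W'0 W'W WC]]] : exists j W',
    [/\ open W', W' !=set0, W' `<=` W & W' `<=` psi @^-1` C j].
  apply: (decided_cover (O := cube d)) => // [j|].
    exact: decided_semialgebraic.
  by rewrite -preimage_bigcup -SE.
have [phi' [psi' [? ? ? ? _]]] := Cdiffeo j.
apply: le_trans (le_bigmax _ _ j); rewrite lee_fin ler_nat.
have chart' : smooth_chart (C j) phi' psi' by [].
exact: chart_dim_le chart chart' oW' W'0 (subset_trans W'W Wd) WC.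
Qed.

End Charts.

(** * Linearizing a solvable polynomial system *)

Section LinearizedSystem.
Context {R : realType}.

Lemma orthogonal_kernel_solvable a b (A : 'M[R]_(a, b)) (u : 'cV[R]_a) :
  (forall v : 'rV[R]_a, v *m A = 0 -> v *m u = 0) -> exists c, A *m c = u.
Proof.
move=> ortho; suff /submxP [c uE] : (u^T <= A^T)%MS.
  by exists c^T; apply: trmx_inj; rewrite trmx_mul trmxK.
rewrite submxE -[_ *m _]trmxK trmx_eq0 trmx_mul trmxK.
apply/eqP/row_matrixP => i; rewrite row_mul row0; apply: ortho.
by rewrite -row_mul -{2}[A]trmxK -trmx_mul mulmx_coker trmx0 row0.
Qed.

Lemma mulmx_rank_factor (n k s : nat) (M : 'M[R]_(n, k)) (A : 'M[R]_(k, s)) :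
  (\rank M <= \rank (M *m A))%N -> exists Z, M = M *m A *m Z.
Proof.
move=> rk; have le : ((M *m A)^T <= M^T)%MS by rewrite trmx_mul submxMl.
have := mxrank_leqif_eq le; rewrite !mxrank_tr => -[_].
rewrite eqn_leq mxrankM_maxl rk /= => /esym/eqmxP eqM.
have /submxP [Z ZE] : (M^T <= (M *m A)^T)%MS by rewrite eqM.
by exists Z^T; apply: trmx_inj; rewrite trmx_mul trmxK.
Qed.

Context {n : nat}.
Implicit Types x : 'rV[R]_n.

Definition evmx x (a b : nat) (A : 'M[mpoly n R]_(a, b)) : 'M[R]_(a, b) :=
  map_mx (meval (fun i => x 0 i)) A.

(** The directional derivative at [x] along [v], taken formally so that it only
sees the polynomial entries of [A]. *)
Definition dmx x (v : 'rV[R]_n) (a b : nat) (A : 'M[mpoly n R]_(a, b)) :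
    'M[R]_(a, b) :=
  map_mx (fun p => dotv (pgrad p x) v) A.

Lemma dmxB x v a b (A B : 'M[mpoly n R]_(a, b)) :
  dmx x v (A - B) = dmx x v A - dmx x v B.
Proof.
by apply/matrixP => i j; rewrite !mxE pgradD dotvDl pgradN dotvNl.
Qed.

Lemma dmxM x v a b c (A : 'M[mpoly n R]_(a, b)) (B : 'M[mpoly n R]_(b, c)) :
  dmx x v (A *m B) = dmx x v A *m evmx x B + evmx x A *m dmx x v B.
Proof.
apply/matrixP => i j; rewrite !mxE pgrad_sum dotv_suml -big_split /=.
apply: eq_bigr => k _; rewrite !mxE pgradM dotvDl !dotvZl addrC /peval.
by congr (_ + _); rewrite mulrC.
Qed.

Lemma dmxC x v a b (A : 'M[R]_(a, b)) : dmx x v (map_mx (@mpolyC n R) A) = 0.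
Proof.
by apply/matrixP => i j; rewrite !mxE pgradC dotv0l.
Qed.

Lemma evmxC x a b (A : 'M[R]_(a, b)) : evmx x (map_mx (@mpolyC n R) A) = A.
Proof. by apply/matrixP => i j; rewrite !mxE mevalC. Qed.

(** Differentiating [M c = F] along [v] formally gives
[dM c0 + M c' = dF], and this is solvable in [c'] as soon as [v] is tangent to
a set [S] on which [M c = F] is solvable and the rank of [M] does not exceed
its value at [x0].

Let [L] and [A] be constant matrices making [N = L M A] the identity at [x0],
of size the rank of [M(x0)]. At the points of [S] where [det N] does not vanish,
the rank of [M A] is that of [M(x0)], so its columns span those of [M]; as
[E = det N - M A (adj N) L] kills [M A], it kills [M] and [F]. So the
entries of [det N * E (F - M c0)] are polynomials that vanish on all of [S].
Since [F - M c0] is zero at [x0], their derivatives along [v] reduce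
to [E(x0) d(F - M c0) = 0], and [E(x0) = 1 - M(x0) A L]: this puts
[d(F - M c0)] in the column space of [M(x0)]. *)
Lemma solvable_linearized (k : nat) (S : set 'rV[R]_n) x0
    (M : 'M[mpoly n R]_(n, k)) (F : 'cV[mpoly n R]_n) (c0 : 'cV[R]_k) v :
    (forall x, S x -> (\rank (evmx x M) <= \rank (evmx x0 M))%N) ->
    (forall x, S x -> exists c, evmx x M *m c = evmx x F) ->
    evmx x0 M *m c0 = evmx x0 F ->
    (forall P, (forall x, S x -> peval P x = 0) -> dotv (pgrad P x0) v = 0) ->
  exists c, evmx x0 M *m c = dmx x0 v F - dmx x0 v M *m c0.
Proof.
move=> rkM MF Mc0 v_tan.
pose C a b (B : 'M[R]_(a, b)) := map_mx (@mpolyC n R) B.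
have /row_fullP [L LM] : row_full (col_base (evmx x0 M)).
  exact: col_base_full.
have /row_freeP [A MA] : row_free (row_base (evmx x0 M)).
  exact: row_base_free.
pose N := C _ _ L *m M *m C _ _ A.
pose G := F - M *m C _ _ c0.
pose E := (\det N)%:M - M *m C _ _ A *m \adj N *m C _ _ L.
have evN x : evmx x N = L *m evmx x M *m A.
  by rewrite /evmx !map_mxM -!/(evmx _ _) !evmxC.
have N0 : evmx x0 N = 1%:M.
  rewrite evN -MA -[row_base _]mul1mx -LM -mulmxA.
  by rewrite -[L *m _ *m _]mulmxA mulmx_base mulmxA.
have evG x : evmx x G = evmx x F - evmx x M *m c0.
  by rewrite /evmx map_mxB map_mxM -!/(evmx _ _) evmxC.
have evE x : evmx x E =
    (\det (evmx x N))%:M - evmx x M *m A *m \adj (evmx x N) *m L.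
  rewrite /evmx map_mxB !map_mxM map_scalar_mx /= -det_map_mx map_mx_adj.
  rewrite -!/(evmx _ _).
  by rewrite !evmxC evN.
have EG x : S x -> \det (evmx x N) != 0 -> evmx x (E *m G) = 0.
  move=> Sx detN.
  have [Z MZ] : exists Z, evmx x M = evmx x M *m A *m Z.
    apply: mulmx_rank_factor; apply: leq_trans (rkM x Sx) _.
    have rkN : \rank (evmx x N) = \rank (evmx x0 M).
      by apply: mxrank_unit; rewrite unitmxE unitfE.
    by rewrite -[leqLHS]rkN evN -mulmxA mxrankM_maxr.
  have EM : evmx x E *m evmx x M = 0.
    rewrite {1}MZ mulmxA evE mulmxBl mul_scalar_mx -!mulmxA.
    rewrite (_ : L *m _ = evmx x N); last by rewrite evN mulmxA.
    by rewrite mul_adj_mx mul_mx_scalar -!scalemxAr subrr mul0mx.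
  have [c MC] := MF x Sx.
  rewrite /evmx map_mxM -!/(evmx _ _) evG -MC -mulmxBr mulmxA EM.
  by rewrite mul0mx.
have dEG : dmx x0 v (E *m G) = 0.
  apply/matrixP => i j; rewrite [LHS]mxE [RHS]mxE.
  (* The factor [det N] makes the entry vanish also where [N] is singular. *)
  have := v_tan (\det N * (E *m G) i j).
  have det0 : peval (\det N) x0 = 1.
    by rewrite /peval -det_map_mx -/(evmx _ _) N0 det1.
  have EG0 : peval ((E *m G) i j) x0 = 0.
    have -> : peval ((E *m G) i j) x0 = evmx x0 (E *m G) i j.
      by rewrite [RHS]mxE.
    by rewrite /evmx map_mxM -!/(evmx _ _) evG Mc0 subrr mulmx0 mxE.
  rewrite pgradM dotvDl !dotvZl det0 EG0 mul0r addr0 mul1r; apply => x Sx.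
  rewrite /peval mevalM -det_map_mx -/(evmx _ _).
  have [->|/(EG x Sx) /matrixP /(_ i j)] := eqVneq (\det (evmx x N)) 0.
    by rewrite mul0r.
  by rewrite mxE => ->; rewrite mxE mulr0.
exists (A *m L *m dmx x0 v G).
move: dEG; rewrite dmxM evG Mc0 subrr mulmx0 add0r evE N0 det1 adj1 mulmx1.
rewrite mulmxBl mul1mx => /eqP; rewrite subr_eq0 => /eqP GE.
by rewrite !mulmxA -GE /G dmxB dmxM dmxC mulmx0 addr0 evmxC.
Qed.

End LinearizedSystem.

(** * Stationary points and multipliers *)

Section Stationary.
Context {R : realType} {n m l : nat}.
Variables (g : 'I_m -> mpoly n R) (h : 'I_l -> mpoly n R).

Lemma tangent_cone_stat (K : set 'rV[R]_n) (f : 'rV[R]_n -> R) x v :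
  stat K f x -> tangent_cone K x v -> 0 <= dotv (grad f x) v.
Proof.
move=> [_ xstat] [y [t [yt _ _ yv]]].
pose w k := (t k)^-1 *: (y k - x).
have lim : dotv (grad f x) (w k) @[k --> \oo] --> dotv (grad f x) v.
  apply: (@continuous_cvg _ _ _ _ _ w (dotv (grad f x))) yv.
  exact: dotv_continuous.
rewrite -(cvg_lim _ lim) //; apply: limr_ge.
  by apply/cvg_ex; exists (dotv (grad f x) v).
apply: nearW => k; have [Ky tk] := yt k.
by rewrite /w dotvZr mulr_ge0 ?invr_ge0 ?(ltW tk) ?xstat.
Qed.

(** A direction orthogonal to all active gradients lies in the linearized cone
together with its opposite, so both are tangent and the objective is stationary
in that direction. *)
Lemma stat_kernel (p q : mpoly n R) (alpha : {set 'I_m}) x v :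
    0 < peval q x -> abadie_cq g h x ->
    stat (feasible g h) (fun y => peval p y / peval q y) x ->
    pseudo_face g h alpha x ->
    (forall i, i \in alpha -> dotv (pgrad (g i) x) v = 0) ->
    (forall j, dotv (pgrad (h j) x) v = 0) ->
  dotv (peval q x *: pgrad p x - peval p x *: pgrad q x) v = 0.
Proof.
move=> q_gt0 acq xstat [_ gx _] gv hv.
have lin s : 0 <= s * dotv (peval q x *: pgrad p x - peval p x *: pgrad q x) v.
  have : tangent_cone (feasible g h) x (s *: v).
    rewrite -acq; split=> [i gi0|j]; rewrite dotvZr ?hv ?mulr0 //.
    have [/gv ->|/gx] := boolP (i \in alpha); first by rewrite mulr0.
    by rewrite gi0 ltxx.
  move=> /(tangent_cone_stat xstat); rewrite grad_quot ?gt_eqF // dotvZl.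
  rewrite pmulr_rge0 ?invr_gt0 ?exprn_gt0 //.
  by rewrite dotvZr.
apply/eqP; rewrite eq_le; have := lin 1; rewrite mul1r => ->.
by have := lin (-1); rewrite mulN1r oppr_ge0 => ->.
Qed.

Variables (p q : mpoly n R) (alpha : {set 'I_m}).

(** The upper right block of [DPsi], kept with polynomial entries so that the
identities it satisfies on a set can be differentiated. *)
Definition constr_mx : 'M[mpoly n R]_(n, #|alpha| + l) :=
  row_mx (\matrix_(a, k) mderiv a (g (enum_val k)))
         (\matrix_(a, j) mderiv a (h j)).

(** The vector [p grad q - q grad p], up to the factor [q ^ 2] the opposite of
the gradient of [p / q]. *)
Definition obj_col : 'cV[mpoly n R]_n :=
  \col_a (p * mderiv a q - q * mderiv a p).

(** Lagrange multipliers of arbitrary sign: the span of the active gradients is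
the orthogonal of its orthogonal, so [stat_kernel] puts the gradient of the
objective in it. *)
Lemma kkt_solvable x :
    0 < peval q x -> abadie_cq g h x ->
    stat (feasible g h) (fun y => peval p y / peval q y) x ->
    pseudo_face g h alpha x ->
  exists c, evmx x constr_mx *m c = evmx x obj_col.
Proof.
move=> q_gt0 acq xstat xface; apply: orthogonal_kernel_solvable => v vM.
apply/matrixP => i j; rewrite !ord1 [RHS]mxE {i j}.
transitivity (- dotv (peval q x *: pgrad p x - peval p x *: pgrad q x) v).
  rewrite mxE /dotv -sumrN; apply: eq_bigr => i _.
  by rewrite !mxE /peval mevalB !mevalM; ring.
apply/eqP; rewrite oppr_eq0; apply/eqP.
have dotE a (Q : 'I_a -> mpoly n R) k :
    dotv (pgrad (Q k) x) v = (v *m evmx x (\matrix_(a, j) mderiv a (Q j))) 0 k.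
  by rewrite mxE; apply: eq_bigr => i _; rewrite !mxE mulrC.
move: vM; rewrite /constr_mx /evmx map_row_mx mul_mx_row => vM.
have := congr1 lsubmx vM; rewrite row_mxKl linear0 => vG.
have := congr1 rsubmx vM; rewrite row_mxKr linear0 => vH.
apply: (stat_kernel q_gt0 acq xstat xface) => [i ai|j].
  rewrite -(enum_rankK_in ai ai) (dotE _ (fun k => g (enum_val k))).
  by rewrite /evmx vG mxE.
by rewrite dotE /evmx vH mxE.
Qed.

End Stationary.

(** * The kernel of the Jacobian matrix *)

Section Bound.
Context {R : realType} {n m l : nat}.
Variables (g : 'I_m -> mpoly n R) (h : 'I_l -> mpoly n R).
Variables (p q : mpoly n R) (alpha : {set 'I_m}).
Local Notation M := (constr_mx g h alpha).
Local Notation F := (obj_col p q).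

(** The linearized multiplier equation is the upper block row of
[DPsi (v, c) = 0]; the hessians of the affine constraints, which do not occur in
[DPsi], vanish. *)
Lemma DPsi_tangent x0 (v : 'rV[R]_n) (c0 c : 'cV[R]_(#|alpha| + l)) :
    (forall j, is_affine (peval (h j))) ->
    (forall i, i \in alpha -> dotv (pgrad (g i) x0) v = 0) ->
    (forall j, dotv (pgrad (h j) x0) v = 0) ->
    evmx x0 M *m c = dmx x0 v F - dmx x0 v M *m c0 ->
  DPsi g h p q x0 (usubmx c0)^T *m col_mx v^T c = 0.
Proof.
move=> h_aff gv hv MC; rewrite /DPsi mul_block_col mul0mx addr0.
have -> : row_mx (\matrix_(a, k) pgrad (g (enum_val k)) x0 0 a)
    (\matrix_(a, j) pgrad (h j) x0 0 a) = evmx x0 M.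
  by rewrite /evmx map_row_mx; congr row_mx; apply/matrixP => a b; rewrite !mxE.
rewrite MC mul_col_mx.
set top := (X in col_mx X _); set bot := (X in col_mx _ X).
have -> : top = 0.
  apply/matrixP => a b; rewrite !ord1 {b} /top mulmxDl.
  have QF : Qmx p q x0 *m v^T + dmx x0 v F = 0.
    apply/matrixP => a' b; rewrite ord1 {b} [LHS]mxE [X in X + _]mxE.
    rewrite [X in _ + X]mxE [RHS]mxE.
    have -> : \sum_j Qmx p q x0 a' j * v^T j 0 =
        dotv (pgrad (q * mderiv a' p - p * mderiv a' q) x0) v.
      by apply: eq_bigr => j _; rewrite !mxE.
    have -> : F a' 0 = - (q * mderiv a' p - p * mderiv a' q).
      by rewrite mxE opprB.
    by rewrite pgradN dotvNl subrr.
  have HM : dmx x0 v M *m c0 = (\sum_(k < #|alpha|)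
      (usubmx c0)^T 0 k *: phess (g (enum_val k)) x0) *m v^T.
    rewrite -{1}[c0]vsubmxK /dmx map_row_mx mul_row_col.
    rewrite [X in _ + X](_ : _ = 0) ?addr0; last first.
      rewrite (_ : map_mx _ _ = 0) ?mul0mx //.
      apply/matrixP => a' j; rewrite !mxE.
      transitivity ((phess (h j) x0 *m v^T) a' 0).
        by rewrite [RHS]mxE; apply: eq_bigr => b _; rewrite !mxE.
      by rewrite phess_affine // mul0mx mxE.
    apply/matrixP => a' b; rewrite ord1 {b} mulmx_suml summxE [LHS]mxE.
    apply: eq_bigr => k _; rewrite -scalemxAl [in RHS]mxE ![in LHS]mxE.
    rewrite [(_^T) 0 k]mxE mulrC.
    congr (_ * _); first by rewrite mxE.
    by rewrite [RHS]mxE; apply: eq_bigr => b _; rewrite !mxE.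
  by rewrite -HM addrACA QF add0r subrr mxE.
have -> : bot = 0; last exact: col_mx0.
rewrite /bot -[RHS]col_mx0; congr col_mx; apply/matrixP => k b;
  rewrite ord1 !mxE {b}.
  rewrite -[RHS](gv _ (enum_valP k)).
  by apply: eq_bigr => j _; rewrite !mxE.
rewrite -[RHS](hv k).
by apply: eq_bigr => j _; rewrite !mxE.
Qed.

(** The rows of [J] span a tangent space of dimension [d] at [x0]. Each of them
extends by a tangent vector of multipliers to an element of the kernel of
[DPsi], and these elements are still linearly independent. *)
Lemma tangent_dim_le d (S : set 'rV[R]_n) x0 (J : 'M[R]_(d, n)) :
    (forall j, is_affine (peval (h j))) -> S x0 ->
    (forall x, S x -> (\rank (evmx x M) <= \rank (evmx x0 M))%N) ->
    (forall x, S x -> exists c, evmx x M *m c = evmx x F) ->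
    (forall x, S x -> pseudo_face g h alpha x) ->
    \rank J = d ->
    (forall P, (forall x, S x -> peval P x = 0) ->
       forall i, dotv (pgrad P x0) (row i J) = 0) ->
  exists lam : 'rV[R]_#|alpha|,
    (d + \rank (DPsi g h p q x0 lam) <= n + #|alpha| + l)%N.
Proof.
move=> h_aff Sx0 rkM MF Sface rkJ J_tan.
have [c0 Mc0] := MF _ Sx0; exists (usubmx c0)^T.
have /choice [c cE] : forall i, exists c : 'cV[R]_(#|alpha| + l),
    evmx x0 M *m c = dmx x0 (row i J) F - dmx x0 (row i J) M *m c0.
  by move=> i; apply: solvable_linearized rkM MF Mc0 _ => P P0; exact: J_tan.
pose X := row_mx J (\matrix_i (c i)^T).
have DX : DPsi g h p q x0 (usubmx c0)^T *m X^T = 0.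
  apply: trmx_inj; rewrite trmx0 trmx_mul trmxK; apply/row_matrixP => i.
  rewrite row_mul row0 -[LHS]trmxK trmx_mul trmxK.
  rewrite row_row_mx rowK tr_row_mx trmxK DPsi_tangent ?trmx0 // => [k ka|j].
    by apply: J_tan => x /Sface [gx _ _]; exact: gx.
  by apply: J_tan => x /Sface [_ _ hx]; exact: hx.
have := mulmx0_rank_max DX; rewrite mxrank_tr => rkX.
rewrite -(addnA n) [leqLHS]addnC; apply: leq_trans rkX.
rewrite leq_add2l -{1}rkJ.
rewrite (_ : J = X *m col_mx 1%:M 0) ?mxrankM_maxl //.
by rewrite mul_row_col mulmx1 mulmx0 addr0.
Qed.

End Bound.

(** * The dimension bound *)

Lemma exists_maximum (T : Type) (W : set T) (f : T -> nat) (b : nat) :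
    W !=set0 -> (forall t, f t <= b)%N ->
  exists2 t0, W t0 & forall t, W t -> (f t <= f t0)%N.
Proof.
move=> [t Wt] fb.
have ex : exists k, `[< exists2 s, W s & f s = k >].
  by exists (f t); apply/asboolP; exists t.
have ub k : `[< exists2 s, W s & f s = k >] -> (k <= b)%N.
  by move=> /asboolP [s _ <-].
have [k /asboolP [t0 Wt0 <-] kmax] := ex_maxnP ex ub.
by exists t0 => // s Ws; apply: kmax; apply/asboolP; exists s.
Qed.

Theorem theorem5p1 (R : realType) (n m l : nat)
    (g : 'I_m -> mpoly n R) (h : 'I_l -> mpoly n R) (p q : mpoly n R)
    (g_convex : forall i, convex_function setT (peval (g i) : 'rV[R]_n -> R^o))
    (h_affine : forall j, is_affine (peval (h j)))
    (K_nonempty : feasible g h !=set0)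
    (q_gt0 : forall x, feasible g h x -> 0 < peval q x)
    (acq : forall x, feasible g h x -> abadie_cq g h x)
    (r : {set 'I_m} -> nat)
    (rank_const : forall (alpha : {set 'I_m}) (x : 'rV[R]_n)
       (lam : 'rV[R]_#|alpha|), \rank (DPsi g h p q x lam) = r alpha)
    (dimStat : \bar R) (dimK : {set 'I_m} -> \bar R)
    (dimStatP :
       is_dim (stat (feasible g h) (fun x => peval p x / peval q x)) dimStat)
    (dimKP : forall alpha, is_dim (pseudo_face g h alpha) (dimK alpha)) :
  (dimStat <= \big[maxe/-oo]_(alpha : {set 'I_m})
     mine (dimK alpha) ((n + #|alpha| + l - r alpha)%N%:R)%:E)%E.
Proof.
have [N [C [d [statE _ _ Cdiffeo ->]]]] := dimStatP.
apply: bigmax_le => [|i _]; first exact: leNye.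
have [phi [psi [phiP psiP phi_smooth psi_smooth _]]] := Cdiffeo i.
have chart : smooth_chart (C i) phi psi by [].
have psi_stat t : @cube R (d i) t ->
    stat (feasible g h) (fun x => peval p x / peval q x) (psi t).
  by move=> /psiP [Ct _]; rewrite statE; exists i.
have [alpha [W [oW W0 Wd Wface]]] : exists alpha W, [/\ open W, W !=set0,
    W `<=` @cube R (d i) & W `<=` psi @^-1` pseudo_face g h alpha].
  apply: (decided_cover (O := @cube R (d i))) => //.
  - move=> alpha; apply: decided_is_dim (dimKP alpha) => t.
    exact: chart_continuous chart.
  - exact: open_cube.
  - exact: cube_neq0.
  move=> t dt; have [[gt ht] _] := psi_stat t dt.
  exists [set j | peval (g j) (psi t) == 0]%SET => //.
  split=> // j; rewrite inE; first by move=> /eqP.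
  by rewrite lt_neqAle gt andbT.
apply: le_trans (le_bigmax _ _ alpha).
rewrite le_min; apply/andP; split.
  exact: chart_is_dim_le chart (dimKP alpha) oW W0 Wd Wface.
pose rk t := \rank (evmx (psi t) (constr_mx g h alpha)).
have [|t0 Wt0 rk_max] := @exists_maximum _ W rk n W0.
  by move=> t; exact: rank_leq_row.
have [J rkJ J_tan] := chart_tangent chart oW Wt0 Wd.
have [lam] : exists lam : 'rV[R]_#|alpha|,
    (d i + \rank (DPsi g h p q (psi t0) lam) <= n + #|alpha| + l)%N.
  apply: (tangent_dim_le (S := psi @` W) h_affine _ _ _ _ rkJ).
  - by exists t0.
  - by move=> _ [t Wt <-]; exact: rk_max.
  - move=> _ [t Wt <-]; have tstat := psi_stat t (Wd t Wt).
    have tfeas : feasible g h (psi t) by case: tstat.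
    by apply: (kkt_solvable _ _ tstat); [exact: q_gt0|exact: acq|exact: Wface].
  - by move=> _ [t Wt <-]; exact: Wface.
  - by move=> P P0; apply: J_tan => s Ws; apply: P0; exists s.
rewrite rank_const => dim_le; rewrite lee_fin ler_nat.
rewrite leq_subRL ?[(r alpha + _)%N]addnC //.
exact: leq_trans (leq_addl _ _) dim_le.
Qed.
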